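(* Let $m,n$ be positive integers and let $G$ be one of the graphs $RG_m(n)$, $TkC_m(n)$, $MS_m(n)$. The code matrix $[\alpha_{i,j}]_{m\times n}$ of any 2-factor of $G$ satisfies the following properties. 1. (Column conditions) For every $j$ with $1\le j\le n$: (a) the ordered pairs $(\alpha_{i,j},\alpha_{i+1,j})$, $1\le i\le m-1$, are arcs of the digraph $\mathcal D_{ud}$; (b) $\alpha_{1,j}\in\{a,d,e\}$ and $\alpha_{m,j}\in\{c,e,f\}$. 2. (Adjacency of column condition) For every $j$ with $1\le j\le n-1$, the ordered pairs $(\alpha_{i,j},\alpha_{i,j+1})$, $1\le i\le m$, are arcs of the digraph $\mathcal D_{lr}$. 3. (First and last column conditions) (a) If $G=RG_m(n)$, then the first column consists of letters from $\{a,b,c\}$ and the last column consists of letters from $\{b,d,f\}$. (b) If $G=TkC_m(n)$, then the ordered pairs $(\alpha_{i,n},\alpha_{i,1})$, $1\le i\le m$, are arcs of $\mathcal D_{lr}$. (c) If $G=MS_m(n)$, then the ordered pairs $(\overline{\alpha}_{i,n},\alpha_{m-i+1,1})$, $1\le i\le m$, are arcs of $\mathcal D_{lr}$. Conversely, every matrix $[\alpha_{i,j}]_{m\times n}$ with entries from $\{a,b,c,d,e,f\}$ that satisfies conditions 1--3 (with the part of 3 relevant to $G$) determines a unique 2-factor of $G$ (i.e. is the code matrix of exactly one 2-factor of $G$).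
   Context: All three graphs have vertex set $\{1,\dots,m\}\times\{1,\dots,n\}$ (row $i$ counted from the top, column $j$ from the left) and contain one vertical edge joining $(i,j)$ and $(i+1,j)$ for $1\le i\le m-1$, $1\le j\le n$, and one horizontal edge joining $(i,j)$ and $(i,j+1)$ for $1\le i\le m$, $1\le j\le n-1$. $RG_m(n)=P_m\times P_n$ has no further edges. $TkC_m(n)=P_m\times C_n$ has in addition, for each $i$, one horizontal ''seam'' edge from $(i,n)$ (leaving it on its right) to $(i,1)$ (entering it on its left). $MS_m(n)$ has in addition, for each $i$, one horizontal ''seam'' edge from $(i,n)$ (leaving on its right) to $(m-i+1,1)$ (entering on its left). For small $n$ these are multigraphs (parallel edges and loops allowed; a loop contributes 2 to the degree). A 2-factor is a spanning 2-regular subgraph (set of edges giving every vertex degree 2). Code matrix: given a 2-factor, each vertex $(i,j)$ is assigned a letter $\alpha_{i,j}$ according to which two of its four sides (up, down, left, right) carry the edge-ends of the 2-factor: $a$ = right and down; $b$ = up and down; $c$ = right and up; $d$ = left and down; $e$ = left and right; $f$ = left and up. The matrix $[\alpha_{i,j}]_{m\times n}$ is the code matrix. Letter reflection in a horizontal axis: $\overline a=c,\ \overline b=b,\ \overline c=a,\ \overline d=f,\ \overline e=e,\ \overline f=d$. Digraph $\mathcal D_{ud}$ on $\{a,b,c,d,e,f\}$: arcs from each of $a,b,d$ to each of $b,c,f$, and from each of $c,e,f$ to each of $a,d,e$. Digraph $\mathcal D_{lr}$ on $\{a,b,c,d,e,f\}$: arcs from each of $a,c,e$ to each of $d,e,f$,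 and from each of $b,d,f$ to each of $a,b,c$. *)

(* Defs.v *)
From HB Require Import structures.
From mathcomp Require Import all_boot all_order all_algebra.
Set Implicit Arguments.
Unset Strict Implicit.
Unset Printing Implicit Defensive.

Inductive side := Up | Down | Left | Right.

Definition side_code (s : side) : bool * bool :=
  match s with
  | Up => (false, false) | Down => (false, true)
  | Left => (true, false) | Right => (true, true)
  end.
Definition side_decode (p : bool * bool) : side :=
  match p with
  | (false, false) => Up | (false, true) => Down
  | (true, false) => Left | (true, true) => Right
  end.
Lemma side_codeK : cancel side_code side_decode. Proof. by case. Qed.
HB.instance Definition _ := Countable.copy side (can_type side_codeK).
HB.instance Definition _ : isFinite side := CanIsFinite side_codeK.

Inductive letter := La | Lb | Lc | Ld | Le | Lf.

Definition sides (x : letter) : {set side} :=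
  match x with
  | La => [set Right; Down]
  | Lb => [set Up; Down]
  | Lc => [set Right; Up]
  | Ld => [set Left; Down]
  | Le => [set Left; Right]
  | Lf => [set Left; Up]
  end.

Definition letter_code (x : letter) : nat :=
  match x with La => 0 | Lb => 1 | Lc => 2 | Ld => 3 | Le => 4 | Lf => 5 end.
Definition letter_decode (k : nat) : option letter :=
  nth None [seq Some x | x <- [:: La; Lb; Lc; Ld; Le; Lf]] k.
Lemma letter_codeK : pcancel letter_code letter_decode. Proof. by case. Qed.
HB.instance Definition _ := Countable.copy letter (pcan_type letter_codeK).

(* Reflection of a letter in a horizontal axis. *)
Definition bar (x : letter) : letter :=
  match x with
  | La => Lc | Lb => Lb | Lc => La | Ld => Lf | Le => Le | Lf => Ld
  end.

Definition D_ud : rel letter := fun x y =>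
     (x \in [:: La; Lb; Ld]) && (y \in [:: Lb; Lc; Lf])
  || (x \in [:: Lc; Le; Lf]) && (y \in [:: La; Ld; Le]).

Definition D_lr : rel letter := fun x y =>
     (x \in [:: La; Lc; Le]) && (y \in [:: Ld; Le; Lf])
  || (x \in [:: Lb; Ld; Lf]) && (y \in [:: La; Lb; Lc]).

(* A finite multigraph drawn so that each of the two ends of an edge leaves its
   vertex through one of the four sides.  Parallel edges and loops are
   allowed. *)
Record multigraph (V : finType) := Multigraph {
  edge : finType;
  end1 : edge -> V * side;
  end2 : edge -> V * side
}.

Section TwoFactors.
Variables (V : finType) (G : multigraph V).
Implicit Types (F : {set edge G}) (v : V) (s : side).

(* A loop contributes 2. *)
Definition degree F v : nat :=
  \sum_(x in F) (((end1 x).1 == v) + ((end2 x).1 == v)).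

Definition two_factor F : Prop := forall v, degree F v = 2.

Definition carries F v s : bool :=
  [exists x in F, (end1 x == (v, s)) || (end2 x == (v, s))].

End TwoFactors.

(* The grids below have m.+1 rows and n.+1 columns, so that m and n ranging over
   nat gives all positive dimensions; indices start at 0, with row 0 at the top
   and column 0 at the left.  For k : 'I_m, the indices [fst_of k] and
   [snd_of k] are the consecutive elements k and k + 1 of 'I_m.+1. *)
Definition fst_of m (k : 'I_m) : 'I_m.+1 := widen_ord (leqnSn m) k.
Definition snd_of m (k : 'I_m) : 'I_m.+1 := lift ord0 k.

Inductive kind := kRG | kTkC | kMS.

Section Grids.
Variables m n : nat.

Definition vertex : finType := ('I_m.+1 * 'I_n.+1)%type.

Section Seams.
(* A seam edge k leaves the last column in row [dep k] and enters the first
   column in row [arr k]. *)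
Variables (S : finType) (dep arr : S -> 'I_m.+1).

(* The summands are the vertical, the horizontal and the seam edges; the first
   index of an edge is its row, that of its upper end when it is vertical. *)
Definition grid_edge : finType :=
  ('I_m * 'I_n.+1 + 'I_m.+1 * 'I_n + S)%type.

Definition grid_end1 (x : grid_edge) : vertex * side :=
  match x with
  | inl (inl (i, j)) => ((fst_of i, j), Down)
  | inl (inr (i, j)) => ((i, fst_of j), Right)
  | inr k => ((dep k, ord_max), Right)
  end.

Definition grid_end2 (x : grid_edge) : vertex * side :=
  match x with
  | inl (inl (i, j)) => ((snd_of i, j), Up)
  | inl (inr (i, j)) => ((i, snd_of j), Left)
  | inr k => ((arr k, ord0), Left)
  end.

Definition grid : multigraph vertex := Multigraph grid_end1 grid_end2.
End Seams.

Definition RG : multigraph vertex := grid (of_void _) (of_void _).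
Definition TkC : multigraph vertex := grid (fun i => i) (fun i => i).
Definition MS : multigraph vertex := grid (fun i => i) (@rev_ord m.+1).

Definition is_code_matrix (G : multigraph vertex) (F : {set edge G})
    (A : 'M[letter]_(m.+1, n.+1)) : Prop :=
  forall i j, sides (A i j) = [set s | carries F (i, j) s].

Implicit Type A : 'M[letter]_(m.+1, n.+1).

Definition column_conditions A : Prop :=
  forall j,
    (forall i : 'I_m, D_ud (A (fst_of i) j) (A (snd_of i) j)) /\
    (A ord0 j \in [:: La; Ld; Le] /\ A ord_max j \in [:: Lc; Le; Lf]).

Definition adjacent_columns_condition A : Prop :=
  forall (j : 'I_n) i, D_lr (A i (fst_of j)) (A i (snd_of j)).

Definition graph_of (k : kind) : multigraph vertex :=
  match k with kRG => RG | kTkC => TkC | kMS => MS end.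

Definition first_last_column_conditions (k : kind) A : Prop :=
  match k with
  | kRG => forall i,
      A i ord0 \in [:: La; Lb; Lc] /\ A i ord_max \in [:: Lb; Ld; Lf]
  | kTkC => forall i, D_lr (A i ord_max) (A i ord0)
  | kMS => forall i, D_lr (bar (A i ord_max)) (A (rev_ord i) ord0)
  end.

Definition code_conditions (k : kind) A : Prop :=
  [/\ column_conditions A,
      adjacent_columns_condition A
    & first_last_column_conditions k A].

End Grids.

(* Main.v *)
Require Import Defs.
From mathcomp Require Import all_boot all_order all_algebra.

(** Call a pair (vertex, side) a slot. In each of the three graphs a slot holds
    at most one edge-end, so an edge set [F] is known as soon as one knows which
    slots it occupies, and the degree of a vertex is the number of its occupied
    slots ([degreeE]), loops included.  Hence a choice [h] of a set of sides at
    every vertex comes from an edge set exactly when the two slots of each edge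
    are both chosen or both not chosen, and no slot without an edge-end is
    chosen; the edge set is then unique ([realized_fits], [fits_realized],
    [realized_inj]).

    The six letters are exactly the two-element sets of sides ([sides_inj],
    [card_sides], [card2_sides]), so code matrices amount to the choices [h]
    of two sides at every vertex, and two-factors to the edge sets realizing
    such choices.  What remains is to read the criterion on matrices.  The arcs
    of [D_ud] and [D_lr] say precisely that two facing slots are chosen
    together ([D_udE], [D_lrE]), which is the first half of the criterion along
    vertical, horizontal and seam edges; for the Moebius strip the bar is
    harmless because the reflection fixes Left and Right ([D_lr_bar]).  The
    second half concerns the slots without an edge-end: the upper and lower
    boundary, and, when there are no seam edges, the left and right boundary
    ([fits_grid]). *)

Set Implicit Arguments.
Unset Strict Implicit.
Unset Printing Implicit Defensive.

(** * Letters as two-element sets of sides *)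

Lemma sides_inj : injective sides.
Proof.
move=> x y /setP eq_xy.
move: (eq_xy Up) (eq_xy Down) (eq_xy Left) (eq_xy Right).
by case: x eq_xy => _; case: y; rewrite /sides !inE.
Qed.

Lemma card_sides x : #|sides x| = 2.
Proof. by case: x; rewrite /sides cards2. Qed.

Lemma card2_sides (B : {set side}) : #|B| = 2 -> exists x, sides x = B.
Proof.
move/eqP/cards2P => [s [t [neq_st ->]]].
case: s t neq_st => [] [] // _;
  [exists Lb | exists Lf | exists Lc | exists Lb | exists Ld | exists La
  |exists Lf | exists Ld | exists Le | exists Lc | exists La | exists Le];
  by rewrite //= setUC.
Qed.

Lemma D_udE x y : D_ud x y = ((Down \in sides x) == (Up \in sides y)).
Proof. by case: x; case: y; rewrite /sides !inE. Qed.

Lemma D_lrE x y : D_lr x y = ((Right \in sides x) == (Left \in sides y)).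
Proof. by case: x; case: y; rewrite /sides !inE. Qed.

Lemma D_lr_bar x y : D_lr (bar x) y = D_lr x y.
Proof. by case: x; case: y. Qed.

Lemma no_Up x : (x \in [:: La; Ld; Le]) = (Up \notin sides x).
Proof. by case: x; rewrite /sides !inE. Qed.

Lemma no_Down x : (x \in [:: Lc; Le; Lf]) = (Down \notin sides x).
Proof. by case: x; rewrite /sides !inE. Qed.

Lemma no_Left x : (x \in [:: La; Lb; Lc]) = (Left \notin sides x).
Proof. by case: x; rewrite /sides !inE. Qed.

Lemma no_Right x : (x \in [:: Lb; Ld; Lf]) = (Right \notin sides x).
Proof. by case: x; rewrite /sides !inE. Qed.

(** * Edge sets and the slots they occupy *)

Section Slots.
Variables (V : finType) (G : multigraph V).
Implicit Types (F : {set edge G}) (h : V -> {set side}).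

Definition separate_ends : Prop :=
  [/\ injective (@end1 _ G), injective (@end2 _ G)
    & forall x y : edge G, end1 x != end2 y].

Definition realized F h : Prop := forall v, h v = [set s | carries F v s].

Definition chosen h (p : V * side) : bool := p.2 \in h p.1.

(** The criterion for [h] to be the set of slots occupied by some edge set;
    the full edge set carries exactly the slots that hold an edge-end. *)
Definition fits h : Prop :=
  (forall x : edge G, chosen h (end1 x) = chosen h (end2 x)) /\
  (forall v s, s \in h v -> carries [set: edge G] v s).

Hypothesis sepG : separate_ends.

Lemma edge_at_uniq (p : V * side) (x y : edge G) :
  (end1 x == p) || (end2 x == p) -> (end1 y == p) || (end2 y == p) -> x = y.
Proof.
case: sepG => inj1 inj2 neq12.
case/orP=> /eqP <- /orP[] /eqP; [by move/inj1 | | | by move/inj2].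
- by move=> eq21; have := neq12 x y; rewrite eq21 eqxx.
- by move=> eq12; have := neq12 y x; rewrite eq12 eqxx.
Qed.

Lemma carries_end1 F (x : edge G) :
  carries F (end1 x).1 (end1 x).2 = (x \in F).
Proof.
rewrite /carries -surjective_pairing.
apply/exists_inP/idP => [[y yF at_y]|xF]; last by exists x; rewrite ?eqxx.
by rewrite (@edge_at_uniq (end1 x) x y) ?eqxx.
Qed.

Lemma carries_end2 F (x : edge G) :
  carries F (end2 x).1 (end2 x).2 = (x \in F).
Proof.
rewrite /carries -surjective_pairing.
apply/exists_inP/idP => [[y yF at_y]|xF]; last by exists x; rewrite ?eqxx ?orbT.
by rewrite (@edge_at_uniq (end2 x) x y) ?eqxx ?orbT.
Qed.

Lemma sum_ends_slot F (p : V * side) :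
  \sum_(x in F) ((end1 x == p) + (end2 x == p)) = carries F p.1 p.2.
Proof.
have addE (x : edge G) :
    (end1 x == p) + (end2 x == p) = ((end1 x == p) || (end2 x == p)) :> nat.
  case: eqP => [eq1|_] //; case: eqP => [eq2|_] //.
  by case: sepG => _ _ /(_ x x); rewrite eq1 eq2 eqxx.
under eq_bigr do rewrite addE.
rewrite /carries -surjective_pairing; case: exists_inP => [[x xF at_x]|no_x].
  rewrite (bigD1 x) //= at_x big1 // => y /andP[_ neq_yx].
  case: (boolP (_ || _)) => // at_y.
  by rewrite (edge_at_uniq at_y at_x) eqxx in neq_yx.
rewrite big1 // => x xF; case: (boolP (_ || _)) => // at_x.
by case: no_x; exists x.
Qed.

(** Each edge-end at [v] sits in exactly one of the four slots of [v], and each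
    slot holds at most one edge-end. *)
Lemma degreeE F v : degree F v = #|[set s | carries F v s]|.
Proof.
have at_vertex (p : V * side) : (p.1 == v) = \sum_s (p == (v, s)) :> nat.
  case: p => w s /=; rewrite (bigD1 s) //= xpair_eqE eqxx andbT big1 ?addn0 //.
  by move=> t neq_ts; rewrite xpair_eqE [s == t]eq_sym (negbTE neq_ts) andbF.
rewrite /degree.
under eq_bigr do rewrite !at_vertex -big_split.
rewrite exchange_big /=.
under eq_bigr do rewrite sum_ends_slot.
by rewrite -sum1dep_card [RHS]big_mkcond; apply: eq_bigr => s _; case: carries.
Qed.

Lemma realized_degree F h v : realized F h -> degree F v = #|h v|.
Proof. by move=> Fh; rewrite degreeE Fh. Qed.

Lemma realized_mem F h : realized F h -> F = [set x | chosen h (end1 x)].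
Proof.
by move=> Fh; apply/setP=> x; rewrite inE /chosen Fh inE carries_end1.
Qed.

Lemma realized_inj F F' h : realized F h -> realized F' h -> F = F'.
Proof. by move=> /realized_mem -> /realized_mem ->. Qed.

Lemma realized_fits F h : realized F h -> fits h.
Proof.
move=> Fh; split=> [x|v s]; last first.
  by rewrite Fh inE => /exists_inP[x _ at_x]; apply/exists_inP; exists x.
by rewrite /chosen !Fh !inE carries_end1 carries_end2.
Qed.

Lemma fits_realized h : fits h -> exists F, realized F h.
Proof.
move=> [both end_of]; exists [set x | chosen h (end1 x)] => v.
apply/setP=> s; rewrite inE.
have chosenE (x : edge G) : (end1 x == (v, s)) || (end2 x == (v, s)) ->
    chosen h (end1 x) = (s \in h v).
  by case/orP=> /eqP eq_x; [rewrite eq_x | rewrite both eq_x].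
apply/idP/exists_inP => [s_h|[x]]; last by rewrite inE => h_x /chosenE <-.
have /exists_inP[x _ at_x] := end_of _ _ s_h.
by exists x; rewrite // inE chosenE.
Qed.

End Slots.

(** * Grids *)

Section GridCriterion.
Variables (m n : nat) (S : finType) (dep arr : S -> 'I_m.+1).
Implicit Type A : 'M[letter]_(m.+1, n.+1).

Let G := grid n dep arr.

Definition matrix_sides A (v : vertex m n) : {set side} := sides (A v.1 v.2).

Lemma is_code_matrixE (F : {set edge G}) A :
  is_code_matrix F A <-> realized F (matrix_sides A).
Proof. by split=> [FA [i j]|FA i j]; [exact: FA | exact: (FA (i, j))]. Qed.

Lemma fst_of_inj k : injective (@fst_of k).
Proof. by move=> i j /(congr1 val) /= /val_inj. Qed.

Lemma snd_of_inj k : injective (@snd_of k).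
Proof. exact: lift_inj. Qed.

Lemma fst_of_neq_max k (i : 'I_k) : fst_of i != ord_max.
Proof. by rewrite -val_eqE /= ltn_eqF. Qed.

Lemma snd_of_neq0 k (i : 'I_k) : snd_of i != ord0.
Proof. by rewrite eq_sym neq_lift. Qed.

Lemma fst_ofP k (i : 'I_k.+1) : i != ord_max -> exists j, i = fst_of j.
Proof.
rewrite -val_eqE /= => neq_ik.
have lt_ik : i < k by rewrite ltn_neqAle neq_ik -ltnS ltn_ord.
by exists (Ordinal lt_ik); apply: val_inj.
Qed.

Lemma snd_ofP k (i : 'I_k.+1) : i != ord0 -> exists j, i = snd_of j.
Proof. by rewrite eq_sym => /unlift_some[j -> _]; exists j. Qed.

(** First ends lie in the slots Down and Right, second ends in Up and Left. *)
Lemma grid_separate_ends :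
  injective dep -> injective arr -> separate_ends G.
Proof.
move=> inj_dep inj_arr; split.
- move=> [[[i j]|[i j]]|k] [[[i' j']|[i' j']]|k'] //= /eqP;
    rewrite !xpair_eqE ?andbT ?andbF //.
  + by move=> /andP[/eqP/fst_of_inj -> /eqP ->].
  + by move=> /andP[/eqP -> /eqP/fst_of_inj ->].
  + by rewrite (negbTE (fst_of_neq_max _)) andbF.
  + by rewrite [_ == fst_of _]eq_sym (negbTE (fst_of_neq_max _)) andbF.
  + by rewrite eqxx andbT => /eqP/inj_dep ->.
- move=> [[[i j]|[i j]]|k] [[[i' j']|[i' j']]|k'] //= /eqP;
    rewrite !xpair_eqE ?andbT ?andbF //.
  + by move=> /andP[/eqP/snd_of_inj -> /eqP ->].
  + by move=> /andP[/eqP -> /eqP/snd_of_inj ->].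
  + by move=> /eqP/inj_arr ->.
- by move=> [[[i j]|[i j]]|k] [[[i' j']|[i' j']]|k'] //=;
    rewrite xpair_eqE andbF.
Qed.

Lemma carries_ends (x : edge G) :
  carries [set: edge G] (end1 x).1 (end1 x).2 /\
  carries [set: edge G] (end2 x).1 (end2 x).2.
Proof.
by rewrite /carries -!surjective_pairing; split; apply/exists_inP;
  exists x; rewrite ?inE ?eqxx ?orbT.
Qed.

Lemma carries_Up i j :
  carries [set: edge G] (i, j) Up = (i != ord0).
Proof.
apply/idP/idP => [/exists_inP[[[[i' j']|[i' j']]|k] _]|].
- by case/orP=> /eqP [] // <- _; exact: snd_of_neq0.
- by case/orP=> /eqP [].
- by case/orP=> /eqP [].
- by move=> /snd_ofP[i' ->]; case: (carries_ends (inl (inl (i', j)))).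
Qed.

Lemma carries_Down i j :
  carries [set: edge G] (i, j) Down = (i != ord_max).
Proof.
apply/idP/idP => [/exists_inP[[[[i' j']|[i' j']]|k] _]|].
- by case/orP=> /eqP [] // <- _; exact: fst_of_neq_max.
- by case/orP=> /eqP [].
- by case/orP=> /eqP [].
- by move=> /fst_ofP[i' ->]; case: (carries_ends (inl (inl (i', j)))).
Qed.

Lemma carries_Left i j :
  carries [set: edge G] (i, j) Left = (j != ord0) || (i \in codom arr).
Proof.
apply/idP/idP => [/exists_inP[[[[i' j']|[i' j']]|k] _]|].
- by case/orP=> /eqP [].
- by case/orP=> /eqP [] // _ <-; rewrite snd_of_neq0.
- by case/orP=> /eqP [] // <- _; rewrite codom_f orbT.
- case: (eqVneq j ord0) => [->|/snd_ofP[j' -> _]] /=.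
    by move/codomP=> [k ->]; case: (carries_ends (inr k)).
  by case: (carries_ends (inl (inr (i, j')))).
Qed.

Lemma carries_Right i j :
  carries [set: edge G] (i, j) Right = (j != ord_max) || (i \in codom dep).
Proof.
apply/idP/idP => [/exists_inP[[[[i' j']|[i' j']]|k] _]|].
- by case/orP=> /eqP [].
- by case/orP=> /eqP [] // _ <-; rewrite fst_of_neq_max.
- by case/orP=> /eqP [] // <- _; rewrite codom_f orbT.
- case: (eqVneq j ord_max) => [->|/fst_ofP[j' -> _]] /=.
    by move/codomP=> [k ->]; case: (carries_ends (inr k)).
  by case: (carries_ends (inl (inr (i, j')))).
Qed.

(** The common form of the three versions of the first and last column
    conditions: the first clause is vacuous for the rectangular grid, the other
    two for the cylinder and the Moebius strip. *)
Definition seam_conditions A : Prop :=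
  [/\ forall k, D_lr (A (dep k) ord_max) (A (arr k) ord0),
      forall i, i \notin codom dep -> Right \notin sides (A i ord_max)
    & forall i, i \notin codom arr -> Left \notin sides (A i ord0)].

Lemma fits_grid A :
  fits G (matrix_sides A) <->
  [/\ column_conditions A, adjacent_columns_condition A & seam_conditions A].
Proof.
split=> [[both end_of]|[col adj [seam noR noL]]].
  have noE i j s : ~~ carries [set: edge G] (i, j) s -> s \notin sides (A i j).
    by apply: contra => s_ij; apply: end_of.
  split=> [j|j i|].
  - split=> [i|]; last first.
      by rewrite no_Up no_Down !noE // ?carries_Up ?carries_Down eqxx.
    by rewrite D_udE; apply/eqP; exact: both (inl (inl (i, j))).
  - by rewrite D_lrE; apply/eqP; exact: both (inl (inr (i, j))).
  split=> [k|i no_dep|i no_arr].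
  - by rewrite D_lrE; apply/eqP; exact: both (inr k).
  - by rewrite noE // carries_Right eqxx.
  - by rewrite noE // carries_Left eqxx.
split=> [[[[i j]|[i j]]|k]|[i j] s].
- by have [/(_ i) + _] := col j; rewrite D_udE => /eqP.
- by have := adj j i; rewrite D_lrE => /eqP.
- by have := seam k; rewrite D_lrE => /eqP.
rewrite /matrix_sides /=; apply: contraLR.
have [_ [top bot]] := col j; rewrite no_Up no_Down in top bot.
case: s.
- by rewrite carries_Up negbK => /eqP ->.
- by rewrite carries_Down negbK => /eqP ->.
- by rewrite carries_Left negb_or negbK => /andP[/eqP -> /noL].
- by rewrite carries_Right negb_or negbK => /andP[/eqP -> /noR].
Qed.

(** The three graphs differ in their seam edges, and the matrix
    conditions only in the form [cond] given to the seam conditions. *)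
Lemma code_matrices_of_grid (cond : 'M[letter]_(m.+1, n.+1) -> Prop) :
    injective dep -> injective arr ->
    (forall A, cond A <-> seam_conditions A) ->
  let conditions A :=
    [/\ column_conditions A, adjacent_columns_condition A & cond A] in
  (forall F : {set edge G}, two_factor F ->
     (exists! A : 'M[letter]_(m.+1, n.+1), is_code_matrix F A) /\
     (forall A : 'M[letter]_(m.+1, n.+1),
        is_code_matrix F A -> conditions A)) /\
  (forall A : 'M[letter]_(m.+1, n.+1), conditions A ->
     exists! F : {set edge G}, two_factor F /\ is_code_matrix F A).
Proof.
move=> inj_dep inj_arr condE conditions.
have conditionsE A : conditions A <-> fits G (matrix_sides A).
  split=> [[col adj /condE seam]|/fits_grid[col adj /condE //]].
  exact/fits_grid.
have sepG := grid_separate_ends inj_dep inj_arr.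
split=> [F F2|A /conditionsE/fits_realized[F FA]].
  split=> [|A /is_code_matrixE FA]; last first.
    exact/conditionsE/(realized_fits sepG FA).
  have letterP (v : vertex m n) : exists x, sides x == [set s | carries F v s].
    have [x <-] := card2_sides (etrans (esym (degreeE sepG F v)) (F2 v)).
    by exists x.
  pose A : 'M[letter]_(m.+1, n.+1) :=
    (\matrix_(i, j) xchoose (letterP (i, j)))%R.
  have FA : is_code_matrix F A.
    by move=> i j; rewrite mxE; exact/eqP/(xchooseP (letterP (i, j))).
  exists A; split=> // B FB; apply/matrixP=> i j; apply: sides_inj.
  by rewrite FA FB.
exists F; split=> [|F' [_ /is_code_matrixE F'A]]; last first.
  exact: realized_inj FA F'A.
split; last exact/is_code_matrixE.
by move=> v; rewrite (realized_degree sepG v FA) card_sides.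
Qed.

End GridCriterion.

(** * The three families of graphs *)

Lemma seam_RG m n (A : 'M[letter]_(m.+1, n.+1)) :
  first_last_column_conditions kRG A <->
  seam_conditions (of_void _) (of_void _) A.
Proof.
have no_row (i : 'I_m.+1) : i \notin codom (of_void 'I_m.+1).
  by apply/codomP=> -[[]].
split=> [ends|[_ noR noL] i]; last by rewrite no_Left no_Right noL ?noR.
by split=> [[]|i _|i _]; have [] := ends i; rewrite no_Left no_Right.
Qed.

Lemma seam_TkC m n (A : 'M[letter]_(m.+1, n.+1)) :
  first_last_column_conditions kTkC A <-> seam_conditions id id A.
Proof.
split=> [seam|[seam _ _] i]; last exact: seam.
by split=> // i; rewrite codom_f.
Qed.

Lemma seam_MS m n (A : 'M[letter]_(m.+1, n.+1)) :
  first_last_column_conditions kMS A <-> seam_conditions id (@rev_ord m.+1) A.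
Proof.
split=> [seam|[seam _ _] i]; last by rewrite D_lr_bar; exact: seam.
split=> [i|i|i]; first by rewrite -D_lr_bar; exact: seam.
  by rewrite codom_f.
by rewrite -[i]rev_ordK codom_f.
Qed.

Theorem lemma2p2 (m n : nat) (k : kind) :
  (forall F : {set edge (graph_of m n k)}, two_factor F ->
     (exists! A : 'M[letter]_(m.+1, n.+1), is_code_matrix F A) /\
     (forall A : 'M[letter]_(m.+1, n.+1),
        is_code_matrix F A -> code_conditions k A)) /\
  (forall A : 'M[letter]_(m.+1, n.+1), code_conditions k A ->
     exists! F : {set edge (graph_of m n k)},
       two_factor F /\ is_code_matrix F A).
Proof.
case: k.
- have inj_void : injective (of_void 'I_m.+1) by case.
  exact: (code_matrices_of_grid inj_void inj_void (@seam_RG m n)).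
- exact: (code_matrices_of_grid (@inj_id 'I_m.+1) (@inj_id _) (@seam_TkC m n)).
- exact: (code_matrices_of_grid (@inj_id 'I_m.+1) rev_ord_inj (@seam_MS m n)).
Qed.
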